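(* Let $x$ be a quadratic irrational number, let $N = \begin{pmatrix} a & b \\ c & d\end{pmatrix} \in \mathbb{Z}^{2,2}$ be a nonsingular integer matrix, let $h_N(x) = \frac{ax+b}{cx+d}$ be the associated M\''obius transformation, and let $n = |\det N|$. Then \[ \frac{1}{S_n} \operatorname{per}(x) \leq \operatorname{per}(h_N(x)) \leq S_n \operatorname{per}(x), \] where \[ S_n = \sum_{\substack{t \in \mathbb{N} \\ t \mid n}} \ \sum_{\substack{j = t\\ j \notin J_t }}^{2t-1} \left(2\left\lfloor \frac{\xi(j,t)}{2} \right\rfloor +1 \right), \qquad J_t = \begin{cases} \emptyset & \text{if } \gcd(t,\tfrac{n}{t}) = 1, \\ \{i \gcd(t,\tfrac{n}{t}) \colon i \in \mathbb{N}\} & \text{otherwise.} \end{cases} \]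
   Context: A quadratic irrational $x$ has an eventually periodic continued fraction expansion $x = [v,\overline{w}]$ with $v \in \mathbb{N}^\ell$, $w \in \mathbb{N}^k$, $k \ge 1$ (the overline denotes infinite repetition of $w$). $\operatorname{per}(x)$ denotes the length of the shortest such $w$, i.e. the least period of the continued fraction expansion of $x$. Since $h_N(x)$ is again a quadratic irrational, $\operatorname{per}(h_N(x))$ is defined likewise. For nonnegative integers $a,c$ not both zero, $\xi(a,c)$ denotes the number of divisions performed by the Euclidean algorithm computing $\gcd(a,c)$ (ending when $0$ is reached); e.g. $\xi(7,0)=\xi(0,7)=0$, $\xi(7,1)=\xi(1,7)=1$, $\xi(13,5)=\xi(5,13)=4$. Here $\mathbb{N}$ includes $0$. *)

(* Defs.v *)
From Stdlib Require Import Reals ZArith.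
From mathcomp Require Import all_boot.

Set Implicit Arguments.
Unset Strict Implicit.

Local Open Scope R_scope.
Definition floorZ (x : R) : Z := (up x - 1)%Z.

Fixpoint cq (x : R) (k : nat) : R :=
  match k with
  | O => x
  | S k' => let y := cq x k' in Rinv (Rminus y (IZR (floorZ y)))
  end.

Definition cf (x : R) (k : nat) : Z := floorZ (cq x k).

(* x is a quadratic irrational: irrational and a root of a nonzero integer
   polynomial of degree at most 2 (hence exactly 2). *)
Definition quadratic_irrational (x : R) : Prop :=
  (forall p q : Z, q <> 0%Z -> x <> (IZR p / IZR q)) /\
  exists A B C : Z, (A <> 0 \/ B <> 0 \/ C <> 0)%Z /\
    (IZR A * x * x + IZR B * x + IZR C = 0).

Definition cf_periodic (x : R) (k : nat) : Prop :=
  (0 < k)%N /\ exists l : nat, forall i : nat, (l <= i)%N -> cf x (i + k) = cf x i.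

Definition is_per (x : R) (k : nat) : Prop :=
  cf_periodic x k /\ forall k', cf_periodic x k' -> (k <= k')%N.

Definition hN (a b c d : Z) (x : R) : R :=
  ((IZR a * x + IZR b) / (IZR c * x + IZR d)).

Local Close Scope R_scope.

Fixpoint euclid_steps (fuel a b : nat) : nat :=
  match fuel with
  | O => 0
  | S f => if b == 0 then 0 else (euclid_steps f b (a %% b)).+1
  end.

Definition xi (a c : nat) : nat := euclid_steps (a + c).+1 (maxn a c) (minn a c).

Definition in_J (n t j : nat) : bool :=
  let g := gcdn t (n %/ t) in (g != 1) && (g %| j).

Definition S_n (n : nat) : nat :=
  \sum_(t < n.+1 | (0 < t) && (t %| n))
     \sum_(t <= j < (2 * t - 1).+1 | ~~ in_J n t j) ((xi j t)./2).*2.+1.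

Example xi_ex1 : xi 7 0 = 0 /\ xi 0 7 = 0 /\ xi 7 1 = 1 /\ xi 1 7 = 1
  /\ xi 13 5 = 4 /\ xi 5 13 = 4.
Proof. by []. Qed.

(* Main.v *)
Require Import Defs.
From Stdlib Require Import Reals ZArith.
From mathcomp Require Import all_boot.
From Stdlib Require Import Lra Lia IndefiniteDescription.
From mathcomp Require Import zify_ssreflect.

(** Up to the left action of GL2(Z), which only changes finitely many partial
    quotients, [N] may be taken primitive and upper triangular with rows
    [(al, -b)] and [(0, t)], where [al * t = n] and [0 <= b < t].  Reading one
    partial quotient of [x], i.e. substituting [x = a + 1/x'], turns the value
    [(al * x - b) / t] into a value of the same kind at [x'], preceded by the
    continued fraction of [(al * a - b) / t], taken with an odd number of terms
    so that the determinant keeps its sign.  That number of terms is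
    [2 * floor (xi j t / 2) + 1] with [t <= j < 2t] and [j = al * a - b] modulo
    [t].  Some of these terms may fail to be positive, but normalising the
    concatenation does not increase its length.

    Along a period of [x] the triangular matrix moves inside a finite set, and
    once it has entered a cycle the matrices met at a given phase of the period
    are pairwise distinct.  Summing over all [(t, j)] gives the upper bound; the
    pairs in [J_t] belong to no primitive matrix.  A non-primitive [N = m N0] is
    covered by [S_n (n0) <= S_n (n0 m^2)], and the lower bound is the upper
    bound for the adjugate of [N]. *)

Set Implicit Arguments.
Unset Strict Implicit.

(** * Complete quotients of irrational numbers *)

Local Open Scope R_scope.

Definition irrational (x : R) : Prop :=
  forall p q : Z, q <> 0%Z -> x <> IZR p / IZR q.

Lemma irrational_neq_IZR x m : irrational x -> x <> IZR m.
Proof. by move=> /(_ m 1%Z) h; have /h : (1 <> 0)%Z by []; lra. Qed.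

Lemma irrational_neq0 x : irrational x -> x <> 0.
Proof. exact: (@irrational_neq_IZR x 0). Qed.

Lemma mobius_den_neq0 a b c d x :
  irrational x -> (a * d - b * c <> 0)%Z -> IZR c * x + IZR d <> 0.
Proof.
move=> irr_x det eq0.
have [c0|c_neq0] := Z.eq_dec c 0.
  move: eq0; rewrite c0 Rmult_0_l Rplus_0_l => /eq_IZR_R0 d0.
  by apply: det; rewrite c0 d0; lia.
apply: (irr_x (- d)%Z c c_neq0).
have c_neq0' : IZR c <> 0 by apply: not_0_IZR.
by rewrite opp_IZR; apply: (Rmult_eq_reg_l (IZR c)) => //; field_simplify => //; lra.
Qed.

Lemma irrational_hN a b c d x :
  irrational x -> (a * d - b * c <> 0)%Z -> irrational (hN a b c d x).
Proof.
move=> irr_x det p q q_neq0 eq_pq.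
have den := mobius_den_neq0 irr_x det.
have q_neq0' : IZR q <> 0 by apply: not_0_IZR.
have eqn : IZR (q * a - p * c) * x + IZR (q * b - p * d) = 0.
  rewrite !minus_IZR !mult_IZR.
  have : IZR q * (IZR a * x + IZR b) = IZR p * (IZR c * x + IZR d).
    transitivity (IZR q * (hN a b c d x * (IZR c * x + IZR d))).
      by rewrite /hN; field.
    by rewrite eq_pq; field.
  by lra.
have [u0|u_neq0] := Z.eq_dec (q * a - p * c) 0.
  move: eqn; rewrite u0 Rmult_0_l Rplus_0_l => /eq_IZR_R0 v0.
  have : (q * (a * d - b * c) = 0)%Z.
    transitivity ((q * a - p * c) * d - (q * b - p * d) * c)%Z; first by ring.
    by rewrite u0 v0.
  by move/Z.mul_eq_0 => [].
by apply: (mobius_den_neq0 (a := 0) (b := 1) irr_x _ eqn); lia.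
Qed.

Lemma irrational_addZ x m : irrational x -> irrational (x + IZR m).
Proof.
move=> irr_x; have -> : x + IZR m = hN 1 m 0 1 x by rewrite /hN; field.
by apply: irrational_hN => //; lia.
Qed.

Lemma irrational_inv x : irrational x -> irrational (/ x).
Proof.
move=> irr_x; have -> : / x = hN 0 1 1 0 x.
  by rewrite /hN; field; exact: irrational_neq0.
by apply: irrational_hN => //; lia.
Qed.

Lemma irrational_opp x : irrational x -> irrational (- x).
Proof.
move=> irr_x; have -> : - x = hN (-1) 0 0 1 x by rewrite /hN; field.
by apply: irrational_hN => //; lia.
Qed.

Lemma irrational_addZ_inv q x : irrational x -> irrational (IZR q + / x).
Proof. by move=> irr_x; rewrite Rplus_comm; apply/irrational_addZ/irrational_inv. Qed.

Lemma floorZ_bounds x : IZR (floorZ x) <= x < IZR (floorZ x) + 1.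
Proof. by rewrite /floorZ minus_IZR; have := archimed x; lra. Qed.

Lemma floorZ_unique x m : IZR m <= x < IZR m + 1 -> floorZ x = m.
Proof.
move=> hm; have hf := floorZ_bounds x.
have : (floorZ x < m + 1)%Z by apply: lt_IZR; rewrite plus_IZR; lra.
have : (m < floorZ x + 1)%Z by apply: lt_IZR; rewrite plus_IZR; lra.
by lia.
Qed.

Lemma cq_add x k l : cq x (k + l) = cq (cq x k) l.
Proof. by elim: l => [|l IHl]; rewrite ?addn0 // addnS /= IHl. Qed.

Lemma cf_cq x k l : cf (cq x k) l = cf x (k + l).
Proof. by rewrite /cf cq_add. Qed.

Lemma cq_expand q r : 1 < r -> cq (IZR q + / r) 1 = r.
Proof.
move=> r_gt1; have r_inv : 0 < / r < 1.
  split; first by apply: Rinv_0_lt_compat; lra.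
  by rewrite -Rinv_1; apply: Rinv_lt_contravar; lra.
rewrite /= (@floorZ_unique _ q); last by lra.
by rewrite (_ : IZR q + / r - IZR q = / r) ?Rinv_inv //; lra.
Qed.

Lemma cq1_decomp x : irrational x ->
  [/\ x = IZR (floorZ x) + / cq x 1, 1 < cq x 1 & irrational (cq x 1)].
Proof.
move=> irr_x; have hf := floorZ_bounds x.
have frac_pos : 0 < x - IZR (floorZ x).
  by have := irrational_neq_IZR (m := floorZ x) irr_x; lra.
split=> /=; first by rewrite Rinv_inv; lra.
  by rewrite -Rinv_1; apply: Rinv_lt_contravar; lra.
apply: irrational_inv; rewrite /Rminus -opp_IZR; exact: irrational_addZ.
Qed.

Lemma irrational_cq x k : irrational x -> irrational (cq x k).
Proof.
move=> irr_x; elim: k => [//|k IHk].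
by rewrite -addn1 cq_add; have [] := cq1_decomp IHk.
Qed.

Lemma cqS_gt1 x k : irrational x -> 1 < cq x k.+1.
Proof.
move=> irr_x; rewrite -addn1 cq_add.
by have [] := cq1_decomp (irrational_cq (k := k) irr_x).
Qed.

Lemma cq_decomp x k : irrational x -> cq x k = IZR (cf x k) + / cq x k.+1.
Proof.
move=> irr_x; rewrite -addn1 cq_add.
by have [] := cq1_decomp (irrational_cq (k := k) irr_x).
Qed.

Fixpoint cprod (x : R) (k : nat) : R :=
  if k is k'.+1 then cprod x k' * cq x k'.+1 else 1.

Lemma cprod_add x k l : cprod x (k + l) = cprod x k * cprod (cq x k) l.
Proof.
elim: l => [|l IHl]; first by rewrite addn0 /=; lra.
by rewrite addnS -[LHS]/(cprod x (k + l) * cq x (k + l).+1) IHl -addnS cq_add /=; lra.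
Qed.

Lemma cprod_gt0 x k : irrational x -> 0 < cprod x k.
Proof.
move=> irr_x; elim: k => [|k IHk] /=; first by lra.
by apply: Rmult_lt_0_compat => //; have := cqS_gt1 k irr_x; rewrite /=; lra.
Qed.

Lemma cprod_ge1 x k : irrational x -> 1 <= cprod x k.
Proof.
move=> irr_x; elim: k => [|k IHk]; first by rewrite /=; lra.
rewrite -[cprod x k.+1]/(cprod x k * cq x k.+1).
by have := cqS_gt1 k irr_x; nra.
Qed.

Lemma cprod_2S_ge x k : irrational x -> 2 * cprod x k <= cprod x k.+2.
Proof.
move=> irr_x.
rewrite -[cprod x k.+2]/(cprod x k * cq x k.+1 * cq x k.+2).
have a_pos : 1 <= IZR (cf x k.+1).
  have [_ hf] := floorZ_bounds (cq x k.+1); have c_gt1 := cqS_gt1 k irr_x.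
  have : (0 < cf x k.+1)%Z by apply: lt_IZR; rewrite /cf; lra.
  by move=> h; apply: IZR_le; lia.
have c_gt1 := cqS_gt1 k.+1 irr_x.
have -> : cprod x k * cq x k.+1 * cq x k.+2 =
          cprod x k * (IZR (cf x k.+1) * cq x k.+2 + 1).
  rewrite [cq x k.+1 in LHS](cq_decomp k.+1 irr_x); field; lra.
have ac_ge1 : 1 <= IZR (cf x k.+1) * cq x k.+2 by nra.
by have := cprod_gt0 k irr_x; nra.
Qed.

Lemma cprod_double_ge x k : irrational x -> INR k <= cprod x (k.*2).
Proof.
move=> irr_x; elim: k => [|k IHk]; first by rewrite /=; lra.
rewrite doubleS S_INR; have := cprod_2S_ge k.*2 irr_x.
by have := cprod_ge1 k.*2 irr_x; lra.
Qed.

Lemma cf_inj x y : irrational x -> irrational y ->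
  (forall i, cf x i = cf y i) -> x = y.
Proof.
move=> irr_x irr_y eq_cf.
have dist k : Rabs (x - y) * (cprod x k * cprod y k) = Rabs (cq x k - cq y k).
  elim: k => [|k IHk]; first by rewrite /=; lra.
  rewrite -[cprod x k.+1]/(cprod x k * cq x k.+1).
  rewrite -[cprod y k.+1]/(cprod y k * cq y k.+1).
  have x1 := cqS_gt1 k irr_x; have y1 := cqS_gt1 k irr_y.
  transitivity (Rabs (x - y) * (cprod x k * cprod y k) * (cq x k.+1 * cq y k.+1)); first by lra.
  rewrite IHk (cq_decomp k irr_x) (cq_decomp k irr_y) eq_cf.
  rewrite -(Rabs_pos_eq (cq x k.+1 * cq y k.+1)); last by nra.
  by rewrite -Rabs_mult Rabs_minus_sym; congr Rabs; field; lra.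
have small k : Rabs (x - y) * INR k <= 1.
  have hd := dist k.*2.
  have : Rabs (cq x k.*2 - cq y k.*2) <= 1.
    have := floorZ_bounds (cq x k.*2); have := floorZ_bounds (cq y k.*2).
    have := eq_cf k.*2; rewrite /cf => ->; move=> h1 h2.
    by apply: Rabs_le; lra.
  rewrite -hd; apply: Rle_trans; apply: Rmult_le_compat_l; first exact: Rabs_pos.
  have := cprod_double_ge k irr_x; have := cprod_ge1 k.*2 irr_y.
  have := cprod_gt0 k.*2 irr_x; nra.
have [//|neq] := Req_dec x y.
have pos : 0 < Rabs (x - y) by apply: Rabs_pos_lt; lra.
have [k hk] := INR_unbounded (/ Rabs (x - y)).
have := small k; have : / Rabs (x - y) * Rabs (x - y) = 1 by apply: Rinv_l; lra.
nra.
Qed.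

Lemma cf_periodic_cq x k l : irrational x ->
  (forall i, (l <= i)%N -> cf x (i + k) = cf x i) -> cq x (l + k) = cq x l.
Proof.
move=> irr_x per; apply: cf_inj; try exact: irrational_cq.
by move=> i; rewrite !cf_cq -addnA (addnC k) addnA per // leq_addr.
Qed.

(** * Comparing the tails of two expansions *)

(* [J] is the automorphy factor: if [y = g z] with [g] in GL2(Z), then
   [g (z, 1) = +- J (y, 1)]. An agreement of [y] with itself for [J > 1] is thus
   a nontrivial shift, i.e. a period. *)
Definition tail_match (y z J : R) (e : Z) : Prop :=
  exists k l : nat, [/\ Z.of_nat k = (Z.of_nat l + e)%Z, cq y k = cq z l
                      & cprod y k = J * cprod z l].

Lemma tail_match_eq y z J J' e e' :
  tail_match y z J e -> J = J' -> e = e' -> tail_match y z J' e'.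
Proof. by move=> h <- <-. Qed.

Lemma tail_match_trans y z w J1 J2 e1 e2 :
  tail_match y z J1 e1 -> tail_match z w J2 e2 ->
  tail_match y w (J1 * J2) (e1 + e2).
Proof.
move=> [k1 [l1 [ekl1 c1 p1]]] [k2 [l2 [ekl2 c2 p2]]].
exists (k1 + k2)%N, (l2 + l1)%N; split; first by lia.
  by rewrite !cq_add c1 -c2 -!cq_add addnC.
rewrite !cprod_add c1 p1 -c2.
transitivity (J1 * cprod z (l1 + k2)); first by rewrite cprod_add; lra.
by rewrite addnC cprod_add p2; lra.
Qed.

Lemma tail_match_sym y z J e :
  J <> 0 -> tail_match y z J e -> tail_match z y (/ J) (- e).
Proof.
move=> J_neq0 [k [l [ekl c p]]]; exists l, k; split; [by lia|by []|].
by rewrite p; field.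
Qed.

Lemma tail_match_refl y : tail_match y y 1 0.
Proof. by exists 0%N, 0%N; split=> //=; lra. Qed.

Lemma tail_match_expand q r : 1 < r -> tail_match (IZR q + / r) r r 1.
Proof.
move=> r_gt1; exists 1%N, 0%N.
by rewrite -[cprod _ 1]/(1 * cq (IZR q + / r) 1) cq_expand //=; split=> //; lra.
Qed.

Lemma tail_match_addZ m y : irrational y -> tail_match (y + IZR m) y 1 0.
Proof.
case/cq1_decomp; set q := floorZ y; set r := cq y 1 => y_eq r_gt1 _.
have y_r := tail_match_expand q r_gt1; rewrite -y_eq in y_r.
have ym_r := tail_match_expand (q + m) r_gt1.
have -> : y + IZR m = IZR (q + m) + / r by rewrite plus_IZR {1}y_eq; lra.
have neq0 : r <> 0 by lra.
have := tail_match_trans ym_r (tail_match_sym neq0 y_r).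
by move/tail_match_eq; apply=> //; field.
Qed.

Lemma tail_match_opp y : irrational y ->
  exists2 e, (e <= 1)%Z & tail_match (- y) y 1 e.
Proof.
case/cq1_decomp; set q := floorZ y; set s := cq y 1 => y_eq s_gt1 irr_s.
have y_s := tail_match_expand q s_gt1; rewrite -y_eq in y_s.
have s_neq0 : s <> 0 by lra.
have s_neq2 := irrational_neq_IZR (m := 2) irr_s.
have [s_gt2|s_lt2] : 2 < s \/ s < 2 by lra.
  exists 1%Z => //.
  have is1 : 0 < / (s - 1) by apply: Rinv_0_lt_compat; lra.
  have h1 : 1 < 1 + / (s - 1) by lra.
  have h2 : 1 < s - 1 by lra.
  have m1 := tail_match_expand (- q - 1) h1.
  have m2 := tail_match_expand 1 h2.
  have m3 : tail_match (s - 1) s 1 0 by exact: (tail_match_addZ (-1) irr_s).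
  have -> : - y = IZR (- q - 1) + / (1 + / (s - 1)).
    by rewrite y_eq minus_IZR opp_IZR; field; lra.
  have := tail_match_trans m1 (tail_match_trans m2 (tail_match_trans m3 (tail_match_sym s_neq0 y_s))).
  by move/tail_match_eq; apply=> //; field; lra.
exists (-1)%Z => //.
set u := / (s - 1); have u_gt1 : 1 < u by rewrite -Rinv_1; apply: Rinv_lt_contravar; lra.
have irr_u : irrational u.
  by apply: irrational_inv; exact: (irrational_addZ (m := -1) irr_s).
have s_eq : s = IZR 1 + / u by rewrite /u Rinv_inv; lra.
have s_u := tail_match_expand 1 u_gt1; rewrite -s_eq in s_u.
have u1_gt1 : 1 < u + 1 by lra.
have m1 := tail_match_expand (- q - 1) u1_gt1.
have m2 : tail_match (u + 1) u 1 0 by exact: tail_match_addZ.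
have -> : - y = IZR (- q - 1) + / (u + 1).
  by rewrite y_eq minus_IZR opp_IZR s_eq; field; lra.
have u_neq0 : u <> 0 by lra.
have := tail_match_trans m1 (tail_match_trans m2
  (tail_match_trans (tail_match_sym u_neq0 s_u) (tail_match_sym s_neq0 y_s))).
by move/tail_match_eq; apply=> //; rewrite s_eq; field; lra.
Qed.

Lemma tail_match_inv_pos q z : irrational z -> 0 < z ->
  exists2 e, (e <= 1)%Z & tail_match (IZR q + / z) z z e.
Proof.
move=> irr_z z_gt0; have z_neq1 := irrational_neq_IZR (m := 1) irr_z.
have [z_gt1|z_lt1] : 1 < z \/ z < 1 by lra.
  by exists 1%Z => //; exact: tail_match_expand.
exists (-1)%Z => //.
have iz_gt1 : 1 < / z by rewrite -Rinv_1; apply: Rinv_lt_contravar; lra.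
have m1 : tail_match z (/ z) (/ z) 1.
  by have := tail_match_expand 0 iz_gt1; rewrite Rinv_inv Rplus_0_l.
have iz_neq0 : / z <> 0 by lra.
have m2 : tail_match (/ z + IZR q) (/ z) 1 0.
  by apply: tail_match_addZ; apply: irrational_inv.
rewrite Rplus_comm.
have := tail_match_trans m2 (tail_match_sym iz_neq0 m1).
by move/tail_match_eq; apply=> //; rewrite Rinv_inv; lra.
Qed.

Lemma tail_match_inv_neg q z : irrational z -> z < 0 ->
  exists2 e, (e <= 3)%Z & tail_match (IZR q + / z) z (- z) e.
Proof.
move=> irr_z z_lt0; have irr_nz := irrational_opp irr_z.
have nz_gt0 : 0 < - z by lra.
have [e1 e1_le m1] := tail_match_inv_pos (- q) irr_nz nz_gt0.
have [e2 e2_le m2] := tail_match_opp irr_z.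
have [e3 e3_le m3] := tail_match_opp (irrational_addZ_inv (q := (- q)%Z) irr_nz).
exists (e3 + (e1 + e2))%Z; first by lia.
have -> : IZR q + / z = - (IZR (- q) + / - z) by rewrite opp_IZR; field; lra.
have := tail_match_trans m3 (tail_match_trans m1 m2).
by move/tail_match_eq; apply=> //; lra.
Qed.

Lemma tail_match_inv_negN1 q z : irrational z -> -1 < z < 0 ->
  exists e, [/\ (e <= 1)%Z, -1/2 < z -> (e <= -1)%Z
              & tail_match (IZR q + / z) z (- z) e].
Proof.
move=> irr_z z_int; set v := / (z + 1).
have v_gt1 : 1 < v by rewrite -Rinv_1; apply: Rinv_lt_contravar; lra.
have irr_v : irrational v by apply: irrational_inv; exact: (irrational_addZ (m := 1) irr_z).
have z_eq : z = IZR (-1) + / v by rewrite /v Rinv_inv; lra.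
have v_neq0 : v <> 0 by lra.
have z_v := tail_match_expand (-1) v_gt1; rewrite -z_eq in z_v.
have v_neq2 := irrational_neq_IZR (m := 2) irr_v.
have v_neq3 := irrational_neq_IZR (m := 3) irr_v.
have y_eq : IZR q + / z = IZR (q - 1) + - / (v - 1).
  by rewrite minus_IZR z_eq; field; lra.
have [v_gt2|v_lt2] : 2 < v \/ v < 2 by lra.
  have half : ~ -1/2 < z.
    move=> z_gt; have : v * (z + 1) = 1 by rewrite /v; field; lra.
    by nra.
  have iv2 : 0 < / (v - 2) by apply: Rinv_0_lt_compat; lra.
  have h1 : 1 < 1 + / (v - 2) by lra.
  have m1 := tail_match_expand (q - 2) h1.
  have y_eq' : IZR q + / z = IZR (q - 2) + / (1 + / (v - 2)).
    by rewrite y_eq !minus_IZR; field; lra.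
  have irr_v2 : irrational (v - 2) by exact: (irrational_addZ (m := -2) irr_v).
  have v2_gt0 : 0 < v - 2 by lra.
  have [e e_le m2] := tail_match_inv_pos 1 irr_v2 v2_gt0.
  have m3 : tail_match (v - 2) v 1 0 by exact: (tail_match_addZ (-2) irr_v).
  exists (1 + (e + (0 + - 1)))%Z; split; [by lia|by []|].
  rewrite y_eq'.
  have := tail_match_trans m1 (tail_match_trans m2
    (tail_match_trans m3 (tail_match_sym v_neq0 z_v))).
  by move/tail_match_eq; apply=> //; rewrite z_eq; field; lra.
set r := / (v - 1); have r_gt1 : 1 < r by rewrite -Rinv_1; apply: Rinv_lt_contravar; lra.
have irr_r : irrational r by apply: irrational_inv; exact: (irrational_addZ (m := -1) irr_v).
have v_eq : v = IZR 1 + / r by rewrite /r Rinv_inv; lra.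
have v_r := tail_match_expand 1 r_gt1; rewrite -v_eq in v_r.
have r_neq0 : r <> 0 by lra.
have [e e_le m2] := tail_match_opp irr_r.
have m1 := tail_match_addZ (q - 1) (irrational_opp irr_r).
exists (0 + (e + (- 1 + - 1)))%Z; split; [by lia|by lia|].
rewrite y_eq -/r Rplus_comm.
have := tail_match_trans m1 (tail_match_trans m2
  (tail_match_trans (tail_match_sym r_neq0 v_r) (tail_match_sym v_neq0 z_v))).
by move/tail_match_eq; apply=> //; rewrite z_eq v_eq; field; lra.
Qed.

(* The number of partial quotients that prefixing [q] to [z] may create in
   excess of one: [q - 1/(K - t)] expands as [q - 1; 1, K - 2, 1, ...]. *)
Definition excess (z : R) : Z := (if Rlt_dec z (-1) then 2 else 0)%Z.

Lemma tail_match_inv q z : irrational z ->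
  exists e, [/\ (e <= 1 + excess z)%Z, -1/2 < z < 0 -> (e <= -1)%Z
              & tail_match (IZR q + / z) z (Rabs z) e].
Proof.
move=> irr_z; rewrite /excess.
have z_neq0 := irrational_neq_IZR (m := 0) irr_z.
have z_neqN1 := irrational_neq_IZR (m := -1) irr_z.
case: Rlt_dec => /= [z_lt|z_ge].
  have z_lt0 : z < 0 by lra.
  have [e e_le m] := tail_match_inv_neg q irr_z z_lt0.
  by exists e; split; [lia|move=> ?; exfalso; lra|rewrite Rabs_left].
have [z_gt0|z_lt0] : 0 < z \/ -1 < z < 0 by lra.
  have [e e_le m] := tail_match_inv_pos q irr_z z_gt0.
  by exists e; split; [lia|move=> ?; exfalso; lra|rewrite Rabs_pos_eq //; lra].
have [e [e_le e_le' m]] := tail_match_inv_negN1 q irr_z z_lt0.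
by exists e; split; [lia|move=> h; apply: e_le'; lra|rewrite Rabs_left //; lra].
Qed.

Lemma tail_match_inv2 a b z : irrational z -> (0 < a)%Z -> (0 < b)%Z ->
  exists2 e, (e + excess (IZR a + / (IZR b + / z)) <= 2 + excess z)%Z
    & tail_match (IZR a + / (IZR b + / z)) z (Rabs (IZR b * z + 1)) e.
Proof.
move=> irr_z a_gt0 b_gt0; set w := IZR b + / z; set z' := IZR a + / w.
have irr_w : irrational w by exact: irrational_addZ_inv.
have [ez [ez_le ez_le' mz]] := tail_match_inv b irr_z.
have [ew [ew_le ew_le' mw]] := tail_match_inv a irr_w.
have z_neq0 := irrational_neq_IZR (m := 0) irr_z.
have w_neq0 := irrational_neq_IZR (m := 0) irr_w.
have a_ge1 : 1 <= IZR a by apply: IZR_le; lia.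
have b_ge1 : 1 <= IZR b by apply: IZR_le; lia.
have w_z : w * z = IZR b * z + 1 by rewrite /w; field.
have z'_w : z' * w = IZR a * w + 1 by rewrite /z'; field.
exists (ew + ez)%Z; last first.
  by have := tail_match_trans mw mz; rewrite -Rabs_mult w_z.
move: ez_le ew_le; rewrite /excess.
case: (Rlt_dec w (-1)) => /= w_N1; case: (Rlt_dec z (-1)) => /= z_N1.
- by nra.
- have z_half : -1/2 < z < 0 by nra.
  have := ez_le' z_half; case: Rlt_dec => /= [z'_N1|_]; [by nra|by lia].
- have w_gt0 : 0 < w by nra.
  case: Rlt_dec => /= [z'_N1|_]; [by nra|by lia].
case: Rlt_dec => /= [z'_N1|_]; last by lia.
have w_half : -1/2 < w < 0 by nra.
by have := ew_le' w_half; lia.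
Qed.

(** * Reading one partial quotient *)

Lemma hN_compose2 a b k11 k12 k21 k22 z : irrational z ->
  (k11 * k22 - k12 * k21 <> 0)%Z ->
  hN ((a * b + 1) * k11 + a * k21) ((a * b + 1) * k12 + a * k22)
     (b * k11 + k21) (b * k12 + k22) z = IZR a + / (IZR b + / hN k11 k12 k21 k22 z).
Proof.
move=> irr_z det; have irr_w := irrational_hN irr_z det.
have den := mobius_den_neq0 irr_z det.
have num : IZR k11 * z + IZR k12 <> 0.
  by apply: (mobius_den_neq0 (a := k21) (b := k22) irr_z); lia.
have den2 : IZR (b * k11 + k21) * z + IZR (b * k12 + k22) <> 0.
  by apply: (mobius_den_neq0 (a := k11) (b := k12) irr_z); nia.
rewrite /hN; rewrite !(plus_IZR, mult_IZR) in den2 *.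
field; repeat split => //; lra.
Qed.

Lemma euclid_block (f u v : nat) : (v < u)%N -> (v < f)%N ->
  exists k11 k12 k21 k22 g : Z,
  [/\ Z.of_nat u = (g * k11)%Z /\ Z.of_nat v = (g * k21)%Z,
      (k11 * k22 - k12 * k21 = 1)%Z, (0 <= k12 < k11)%Z, (k22 <= k21 + 1)%Z
    & forall z, irrational z ->
      exists2 e, (e + excess (hN k11 k12 k21 k22 z) <=
                  Z.of_nat ((euclid_steps f u v).+1./2.*2) + excess z)%Z
        & tail_match (hN k11 k12 k21 k22 z) z (Rabs (IZR k21 * z + IZR k22)) e].
Proof.
elim/ltn_ind: v u f => v IHv u [//|f] v_lt_u v_lt_f.
case: v IHv v_lt_u v_lt_f => [|v] IHv v_lt_u v_lt_f.
  exists 1%Z, 0%Z, 0%Z, 1%Z, (Z.of_nat u); split; try by lia.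
  move=> z irr_z; have -> : hN 1 0 0 1 z = z by rewrite /hN; field.
  exists 0%Z; first by rewrite /=; lia.
  by rewrite Rmult_0_l Rplus_0_l Rabs_pos_eq; [exact: tail_match_refl|lra].
rewrite [euclid_steps _ _ _]/=.
have u_eq := divn_eq u v.+1; have w_lt : (u %% v.+1 < v.+1)%N by rewrite ltn_mod.
set q := (u %/ v.+1)%N in u_eq; set w := (u %% v.+1)%N in u_eq w_lt *.
have q_gt0 : (0 < q)%N by rewrite divn_gt0 // ltnW.
have [w0|w_gt0] := posnP w.
  have q_gt1 : (1 < q)%N by nia.
  exists (Z.of_nat q), (Z.of_nat q - 1)%Z, 1%Z, 1%Z, (Z.of_nat v.+1); split; try by nia.
  move=> z irr_z; rewrite w0.
  have -> : euclid_steps f v.+1 0 = 0%N by case: (f).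
  have a_gt0 : (0 < Z.of_nat q - 1)%Z by lia.
  have [e e_le m] := tail_match_inv2 irr_z a_gt0 (b := 1) erefl.
  have E : hN (Z.of_nat q) (Z.of_nat q - 1) 1 1 z = IZR (Z.of_nat q - 1) + / (IZR 1 + / z).
    have z_id : hN 1 0 0 1 z = z by rewrite /hN; field.
    rewrite -z_id -hN_compose2 ?z_id //; congr hN; ring.
  rewrite E; exists e; first by move: e_le; rewrite /=; lia.
  by apply: tail_match_eq m _ _ => //; rewrite Rmult_1_l.
case: f v_lt_f => [|f] v_lt_f; first by lia.
rewrite [euclid_steps _ _ _]/= (gtn_eqF w_gt0).
have v_eq := divn_eq v.+1 w; have w'_lt : (v.+1 %% w < w)%N by rewrite ltn_mod.
set q' := (v.+1 %/ w)%N in v_eq; set w' := (v.+1 %% w)%N in v_eq w'_lt *.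
have q'_gt0 : (0 < q')%N by rewrite divn_gt0 // ltnW.
have w'_lt_v : (w' < v.+1)%N by lia.
have w'_lt_f : (w' < f)%N by lia.
have [k11 [k12 [k21 [k22 [g [[u_g v_g] det k12_lt k22_le m]]]]]] := IHv w' w'_lt_v w f w'_lt w'_lt_f.
set Q := Z.of_nat q; set Q' := Z.of_nat q'.
have Q_gt0 : (0 < Q)%Z by lia.
have Q'_gt0 : (0 < Q')%Z by lia.
exists ((Q * Q' + 1) * k11 + Q * k21)%Z, ((Q * Q' + 1) * k12 + Q * k22)%Z,
       (Q' * k11 + k21)%Z, (Q' * k12 + k22)%Z, g.
have v_Q : Z.of_nat v.+1 = (Q' * (g * k11) + g * k21)%Z by rewrite -u_g -v_g; lia.
have g_gt0 : (0 < g)%Z by apply/(Z.mul_pos_cancel_r g k11); lia.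
have k21_ge0 : (0 <= k21)%Z by apply/(Z.mul_nonneg_cancel_l g k21); lia.
have k22_ge0 : (0 <= k22)%Z.
  have k1221 : (0 <= k12 * k21)%Z by apply: Z.mul_nonneg_nonneg; lia.
  by apply/(Z.mul_nonneg_cancel_l k11 k22); lia.
have QQ' : (Q <= Q * Q')%Z by nia.
split.
- split; last by rewrite v_Q; ring.
  transitivity (Q * Z.of_nat v.+1 + Z.of_nat w)%Z; first by lia.
  by rewrite v_Q u_g; ring.
- by rewrite -[RHS]det; ring.
- have : (0 <= Q * k22 /\ 0 <= (Q * Q' + 1) * k12)%Z by split; apply: Z.mul_nonneg_nonneg; lia.
  have : (Q * (k22 - k21) <= Q * 1)%Z by apply: Z.mul_le_mono_nonneg_l; lia.
  have : ((Q * Q' + 1) * 1 <= (Q * Q' + 1) * (k11 - k12))%Z by apply: Z.mul_le_mono_nonneg_l; lia.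
  by lia.
- have : (Q' * 1 <= Q' * (k11 - k12))%Z by apply: Z.mul_le_mono_nonneg_l; lia.
  by lia.
move=> z irr_z; have det' : (k11 * k22 - k12 * k21 <> 0)%Z by lia.
have irr_w := irrational_hN irr_z det'.
have [e1 e1_le m1] := m z irr_z.
have [e2 e2_le m2] := tail_match_inv2 irr_w Q_gt0 Q'_gt0.
rewrite (hN_compose2 _ _ irr_z det').
exists (e2 + e1)%Z; first by lia.
have := tail_match_trans m2 m1; move/tail_match_eq; apply=> //.
rewrite -Rabs_mult; congr Rabs; rewrite /hN !(plus_IZR, mult_IZR); field.
exact: (mobius_den_neq0 irr_z det').
Qed.

Definition quotient_bound (j t : nat) : nat := ((xi j t)./2).*2.+1.

Lemma xi_add_small t r : (r < t)%N ->
  xi (t + r) t = (euclid_steps (t + r + t) t r).+1.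
Proof.
move=> r_lt; rewrite /xi (maxn_idPl (leq_addr _ _)) (minn_idPr (leq_addr _ _)).
by rewrite /= modnDl modn_small // gtn_eqF //; lia.
Qed.

Lemma dvdn_Zdivide (d m : nat) : (d %| m)%N <-> (Z.of_nat d | Z.of_nat m)%Z.
Proof.
split=> [/dvdnP [k ->]|[k m_eq]]; first by exists (Z.of_nat k); lia.
apply/dvdnP; exists (Z.abs_nat k); apply: Nat2Z.inj.
have -> : Z.of_nat m = Z.abs (k * Z.of_nat d) by rewrite -m_eq; lia.
by rewrite Z.abs_mul; lia.
Qed.

Lemma gcdn3_eq1P (a b c : nat) : gcdn (gcdn a b) c = 1%N <->
  forall m : Z, (m | Z.of_nat a)%Z -> (m | Z.of_nat b)%Z -> (m | Z.of_nat c)%Z -> (m | 1)%Z.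
Proof.
split=> [gcd1 m ma mb mc|h].
  have abs_m : Z.of_nat (Z.abs_nat m) = Z.abs m by lia.
  apply/Z.divide_abs_l; rewrite -abs_m -[1%Z]/(Z.of_nat 1); apply/dvdn_Zdivide.
  by rewrite -gcd1 !dvdn_gcd; repeat (apply/andP; split); apply/dvdn_Zdivide;
     rewrite abs_m; apply/Z.divide_abs_l.
apply/eqP; rewrite -dvdn1; apply/dvdn_Zdivide; apply: h; apply/dvdn_Zdivide.
- by apply: dvdn_trans (dvdn_gcdl _ _) (dvdn_gcdl _ _).
- by apply: dvdn_trans (dvdn_gcdl _ _) (dvdn_gcdr _ _).
- exact: dvdn_gcdr.
Qed.

Definition upper_mobius (al b t : nat) (x : R) : R :=
  hN (Z.of_nat al) (- Z.of_nat b) 0 (Z.of_nat t) x.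

Lemma upper_mobius_step (al b t a : nat) :
  (0 < al)%N -> (b < t)%N -> gcdn (gcdn al b) t = 1%N ->
  exists al' b' t' : nat,
  [/\ (al' * t' = al * t)%N, (b' < t')%N, gcdn (gcdn al' b') t' = 1%N
    & forall x, irrational x -> 1 < x ->
      exists2 e, (e <= Z.of_nat (quotient_bound (t + (al * a + t - b) %% t) t))%Z
        & tail_match (upper_mobius al b t (INR a + / x)) (upper_mobius al' b' t' x)
            (x * (INR t / INR t')) e].
Proof.
move=> al_gt0 b_lt prim.
have t_gt0 : (0 < t)%N by lia.
set p := (al * a + t - b)%N; have p_eq := divn_eq p t.
have r_lt : (p %% t < t)%N by rewrite ltn_mod.
set Q := (p %/ t)%N in p_eq; set r := (p %% t)%N in p_eq r_lt *.
have r_lt_f : (r < t + r + t)%N by lia.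
have [k11 [k12 [k21 [k22 [g [[t_g r_g] det k12_lt k22_le m]]]]]] := euclid_block r_lt r_lt_f.
have k11_gt0 : (0 < k11)%Z by lia.
have g_gt0 : (0 < g)%Z by nia.
have det' : (k11 * k22 - k12 * k21 <> 0)%Z by lia.
exists (Z.to_nat g), (Z.to_nat (k12 * Z.of_nat al)), (Z.to_nat (k11 * Z.of_nat al)).
have to_al' : Z.of_nat (Z.to_nat g) = g by rewrite Z2Nat.id //; lia.
have to_b' : Z.of_nat (Z.to_nat (k12 * Z.of_nat al)) = (k12 * Z.of_nat al)%Z.
  by rewrite Z2Nat.id //; nia.
have to_t' : Z.of_nat (Z.to_nat (k11 * Z.of_nat al)) = (k11 * Z.of_nat al)%Z.
  by rewrite Z2Nat.id //; nia.
have p_Z : (Z.of_nat al * Z.of_nat a - Z.of_nat b =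
            (Z.of_nat Q - 1) * Z.of_nat t + Z.of_nat r)%Z.
  by move: p_eq; rewrite /p; nia.
split.
- by apply: Nat2Z.inj; rewrite !Nat2Z.inj_mul to_al' to_t' t_g; ring.
- by apply/ltP/Nat2Z.inj_lt; rewrite to_b' to_t'; nia.
- apply/gcdn3_eq1P => c; rewrite to_al' to_b' to_t' => c_g c_b' c_t'.
  have c_al : (c | Z.of_nat al)%Z.
    have -> : Z.of_nat al = (k11 * Z.of_nat al * k22 - k12 * Z.of_nat al * k21)%Z.
      by rewrite -[LHS]Z.mul_1_l -det; ring.
    by apply: Z.divide_sub_r; apply: Z.divide_mul_l.
  move/gcdn3_eq1P: prim; apply=> //; last by rewrite t_g; apply: Z.divide_mul_l.
  have -> : Z.of_nat b = (Z.of_nat al * Z.of_nat a - ((Z.of_nat Q - 1) * Z.of_nat t + Z.of_nat r))%Z by lia.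
  apply: Z.divide_sub_r; first exact: Z.divide_mul_l.
  rewrite t_g r_g; apply: Z.divide_add_r; last exact: Z.divide_mul_l.
  by apply: Z.divide_mul_r; apply: Z.divide_mul_l.
move=> x irr_x x_gt1; rewrite /quotient_bound xi_add_small //.
rewrite /upper_mobius to_al' to_b' to_t'.
set y' := hN g _ 0 _ x.
have irr_y' : irrational y' by apply: irrational_hN => //; nia.
have alR : 0 < IZR (Z.of_nat al) by apply: IZR_lt; lia.
have gR : 0 < IZR g by apply: IZR_lt.
have k11R : 0 < IZR k11 by apply: IZR_lt.
have k12R : 0 <= IZR k12 < IZR k11 by split; [apply: IZR_le; lia|apply: IZR_lt; lia].
have y'_eq : IZR k11 * y' + IZR k12 = IZR g * x / IZR (Z.of_nat al).
  by rewrite /y' /hN opp_IZR !mult_IZR; field; lra.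
have y'_gt : -1 < y'.
  have : 0 < IZR g * x / IZR (Z.of_nat al).
    by apply: Rdiv_lt_0_compat => //; nra.
  by rewrite -y'_eq; nra.
have excess0 : excess y' = 0%Z by rewrite /excess; case: Rlt_dec => //=; lra.
have [e2 e2_le m2] := m y' irr_y'.
have irr_K := irrational_hN irr_y' det'.
have [e1 [e1_le _ m1]] := tail_match_inv (Z.of_nat Q - 1) irr_K.
have den := mobius_den_neq0 irr_y' det'.
have num : IZR k11 * y' + IZR k12 <> 0.
  by apply: (mobius_den_neq0 (a := k21) (b := k22) irr_y'); lia.
exists (e1 + e2)%Z; first by lia.
have -> : hN (Z.of_nat al) (- Z.of_nat b) 0 (Z.of_nat t) (INR a + / x) =
          IZR (Z.of_nat Q - 1) + / hN k11 k12 k21 k22 y'.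
  have detR : IZR k22 = (1 + IZR k12 * IZR k21) / IZR k11.
    apply: (Rmult_eq_reg_l (IZR k11)); last by lra.
    have := f_equal IZR det; rewrite minus_IZR !mult_IZR => detR.
    by field_simplify; lra.
  have den_eq : IZR k21 * y' + IZR k22 =
      (IZR g * IZR k21 * x + IZR (Z.of_nat al)) / (IZR k11 * IZR (Z.of_nat al)).
    by rewrite /y' /hN opp_IZR !mult_IZR detR; field; lra.
  have pR := f_equal IZR p_Z.
  rewrite t_g r_g minus_IZR plus_IZR !mult_IZR in pR.
  have -> : hN k11 k12 k21 k22 y' = (IZR g * x / IZR (Z.of_nat al)) /
      ((IZR g * IZR k21 * x + IZR (Z.of_nat al)) / (IZR k11 * IZR (Z.of_nat al))).
    by rewrite -den_eq -y'_eq.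
  have pos : IZR g * IZR k21 * x + IZR (Z.of_nat al) <> 0.
    by move=> h; apply: den; rewrite den_eq h; lra.
  rewrite /hN t_g INR_IZR_INZ opp_IZR mult_IZR.
  have -> : IZR (Z.of_nat al) * (IZR (Z.of_nat a) + / x) + - IZR (Z.of_nat b) =
      IZR (Z.of_nat al) * IZR (Z.of_nat a) - IZR (Z.of_nat b) + IZR (Z.of_nat al) / x.
    by field; lra.
  by rewrite pR; field; lra.
have := tail_match_trans m1 m2; move/tail_match_eq; apply=> //.
rewrite -Rabs_mult.
have -> : hN k11 k12 k21 k22 y' * (IZR k21 * y' + IZR k22) = IZR k11 * y' + IZR k12.
  by rewrite /hN; field.
rewrite y'_eq Rabs_pos_eq.
  by rewrite !INR_IZR_INZ to_t' t_g !mult_IZR; field; lra.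
apply: Rlt_le; apply: Rdiv_lt_0_compat => //; nra.
Qed.

(** * The sum S_n *)

Local Close Scope R_scope.

Definition S_index (n : nat) : seq (nat * nat) :=
  [seq x <- [seq (t, j) | t <- iota 0 n.+1, j <- iota 0 (2 * n).+1]
     | [&& 0 < x.1, x.1 %| n, x.1 <= x.2, x.2 < 2 * x.1 & ~~ in_J n x.1 x.2]].

Lemma S_index_uniq n : uniq (S_index n).
Proof.
by apply/filter_uniq/allpairs_uniq; rewrite ?iota_uniq // => -[? ?] [? ?] _ _ /=.
Qed.

Lemma mem_S_index n t j : 0 < n ->
  ((t, j) \in S_index n) =
  [&& 0 < t, t %| n, t <= j, j < 2 * t & ~~ in_J n t j].
Proof.
move=> n_gt0; rewrite mem_filter andb_idr // => /and5P [_ t_n t_j j_t _].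
have t_le : t <= n := dvdn_leq n_gt0 t_n.
rewrite /= in t_j j_t.
by apply: (allpairs_f pair); rewrite mem_iota; lia.
Qed.

Lemma S_nE n : 0 < n -> S_n n = \sum_(x <- S_index n) quotient_bound x.2 x.1.
Proof.
move=> n_gt0; rewrite /S_index big_filter big_mkcond big_allpairs.
rewrite /S_n -(big_mkord (fun t => (0 < t) && (t %| n))
  (fun t => \sum_(t <= j < (2 * t - 1).+1 | ~~ in_J n t j) quotient_bound j t)).
rewrite [LHS]big_mkcond {1}/index_iota subn0; apply: eq_bigr => t _.
rewrite /fst /snd.
have [t_gt0|_] := ltnP 0 t; last by rewrite big1.
have [t_n|_] := boolP (t %| n); last by rewrite big1.
have t_le := dvdn_leq n_gt0 t_n.
have -> : (2 * t - 1).+1 = 2 * t by lia.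
rewrite (big_nat_widen _ _ (2 * n).+1); last by lia.
rewrite (big_nat_widenl _ 0) // [LHS]big_mkcond /index_iota subn0.
by apply: eq_bigr => j _ /=; rewrite andbC [_ && (j < _)]andbC.
Qed.

Lemma leq_sum_uniq_sub (I : eqType) (r s : seq I) (F : I -> nat) :
  uniq r -> uniq s -> {subset r <= s} -> \sum_(i <- r) F i <= \sum_(i <- s) F i.
Proof. exact: (uniq_sub_le_big leqnn (fun m k => leq_addr k m)). Qed.

Lemma euclid_steps_scale f k a b : 0 < k ->
  euclid_steps f (a * k) (b * k) = euclid_steps f a b.
Proof.
move=> k_gt0; elim: f a b => [//|f IHf] a b /=.
by rewrite muln_eq0 (gtn_eqF k_gt0) orbF -muln_modl IHf.
Qed.

Lemma euclid_steps_fuel f f' a b : b < f -> b < f' ->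
  euclid_steps f a b = euclid_steps f' a b.
Proof.
elim: f f' a b => [//|f IHf] [//|f'] a b b_f b_f' /=.
have [//|b_neq0] := eqVneq b 0.
by congr S; apply: IHf; (apply: leq_trans (ltn_pmod _ _) _; first by rewrite lt0n); lia.
Qed.

Lemma xi_scale k a c : 0 < k -> xi (a * k) (c * k) = xi a c.
Proof.
move=> k_gt0; rewrite /xi -maxnMl -minnMl euclid_steps_scale //.
by apply: euclid_steps_fuel; rewrite ltnS geq_min; nia.
Qed.

(* [(t, j)] is sent to [(t p^2, j p^2)] if [p] divides [t] but not [n / t], and
   to itself otherwise; this preserves [xi] and never enters [J]. *)
Lemma S_n_leq_mul_prime_sqr n p : 0 < n -> prime p -> S_n n <= S_n (n * p ^ 2).
Proof.
move=> n_gt0 p_pr; have p_gt0 := prime_gt0 p_pr.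
have np_gt0 : 0 < n * p ^ 2 by rewrite muln_gt0 n_gt0 expn_gt0 p_gt0.
pose k t := if (p %| t) && ~~ (p %| n %/ t) then p ^ 2 else 1.
have k_gt0 t : 0 < k t by rewrite /k; case: ifP; rewrite // expn_gt0 p_gt0.
pose h x := (x.1 * k x.1, x.2 * k x.1).
rewrite !S_nE //.
have -> : \sum_(x <- S_index n) quotient_bound x.2 x.1 =
          \sum_(x <- map h (S_index n)) quotient_bound x.2 x.1.
  by rewrite big_map; apply: eq_bigr => x _; rewrite /quotient_bound xi_scale.
apply: leq_sum_uniq_sub; [|exact: S_index_uniq|].
  rewrite map_inj_in_uniq ?S_index_uniq // => -[t j] [t' j'].
  rewrite !mem_S_index // => /and5P [t_gt0 t_n _ _ _] /and5P [t'_gt0 t'_n _ _ _].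
  have excl u v : 0 < v -> u %| n -> v %| n -> v = u * p ^ 2 -> ~~ (p %| n %/ u) -> False.
    move=> v_gt0 u_n v_n v_eq /negP; apply.
    have u_gt0 : 0 < u by move: v_gt0; rewrite v_eq muln_gt0 => /andP [].
    rewrite -(dvdn_pmul2l u_gt0) [u * (n %/ u)]mulnC (divnK u_n).
    by apply: dvdn_trans v_n; rewrite v_eq dvdn_pmul2l // dvdn_exp.
  have t_eq : t * k t = t' * k t' -> t = t'.
    rewrite /k; case: ifP => [/andP [_ nt]|_]; case: ifP => [/andP [_ nt']|_]; rewrite ?muln1 //.
    - by move/eqP; rewrite eqn_pmul2r ?expn_gt0 ?p_gt0 // => /eqP.
    - by move/esym/(excl t t') => /(_ t'_gt0 t_n t'_n nt).
    - by move/(excl t' t) => /(_ t_gt0 t'_n t_n nt').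
  rewrite /h /= => -[] /t_eq <- /eqP; rewrite eqn_pmul2r // => /eqP -> //.
move=> y /mapP [[t j] ]; rewrite mem_S_index // => /and5P [t_gt0 t_n t_j j_t nJ] ->.
rewrite /h /= mem_S_index // muln_gt0 t_gt0 k_gt0 /=.
rewrite leq_pmul2r // t_j mulnA ltn_pmul2r // j_t /=.
have [m n_eq] := dvdnP t_n.
have nt : n %/ t = m by rewrite n_eq mulnK.
have kt : k t = if (p %| t) && ~~ (p %| m) then p ^ 2 else 1 by rewrite /k nt.
move: nJ; rewrite /in_J nt kt; case: ifP => [/andP [p_t p_m]|pp].
  have -> : n * p ^ 2 = m * (t * p ^ 2) by rewrite n_eq mulnA.
  rewrite dvdn_mull // mulnK ?muln_gt0 ?t_gt0 ?expn_gt0 ?p_gt0 //=.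
  have cop : coprime m (p ^ 2) by rewrite coprimeXr // coprime_sym prime_coprime.
  have -> : gcdn (t * p ^ 2) m = gcdn t m by rewrite gcdnC Gauss_gcdl // gcdnC.
  by rewrite Gauss_dvdl // (coprime_dvdl (dvdn_gcdr _ _)).
have -> : n * p ^ 2 = m * p ^ 2 * t by rewrite n_eq mulnAC.
rewrite !muln1 dvdn_mull // mulnK //=.
have [p_t|p_nt] := boolP (p %| t); last first.
  by rewrite Gauss_gcdl // coprime_sym coprimeXl // prime_coprime.
have p_m : p %| m by apply: contraFT pp => ->; rewrite p_t.
have g_g' : gcdn t m %| gcdn t (m * p ^ 2).
  by rewrite dvdn_gcd dvdn_gcdl dvdn_mulr // dvdn_gcdr.
have g_neq1 : gcdn t m != 1.
  apply: contraTneq p_pr => g1; have : p %| gcdn t m by rewrite dvdn_gcd p_t.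
  by rewrite g1 dvdn1 => /eqP ->.
rewrite g_neq1 /=; apply: contra => /andP [_]; exact: dvdn_trans.
Qed.

Lemma S_n_leq_mul_sqr n m : 0 < n -> 0 < m -> S_n n <= S_n (n * m ^ 2).
Proof.
move=> n_gt0; elim/ltn_ind: m => m IHm m_gt0.
have [m_le1|m_gt1] := leqP m 1.
  by rewrite (_ : m = 1) ?muln1 //; lia.
have := pdiv_prime m_gt1; have [m' m_eq] := dvdnP (pdiv_dvd m).
move: (pdiv m) m_eq => p m_eq p_pr; have p_gt1 := prime_gt1 p_pr.
have m'_gt0 : 0 < m' by move: m_gt0; rewrite m_eq muln_gt0 => /andP [].
apply: (leq_trans (IHm m' _ m'_gt0)); first by rewrite m_eq ltn_Pmulr.
have -> : n * m ^ 2 = n * m' ^ 2 * p ^ 2 by rewrite m_eq expnMn mulnA.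
by apply: S_n_leq_mul_prime_sqr => //; rewrite muln_gt0 n_gt0 expn_gt0 m'_gt0.
Qed.

(* A state [(t, b)] stands for the matrix with rows [(n / t, -b)] and [(0, t)]. *)
Definition state_weight (n a : nat) (s : nat * nat) : nat :=
  quotient_bound (s.1 + (n %/ s.1 * a + s.1 - s.2) %% s.1) s.1.

Definition valid_state (n : nat) (s : nat * nat) : bool :=
  [&& 0 < s.1, s.1 %| n, s.2 < s.1 & gcdn (gcdn (n %/ s.1) s.2) s.1 == 1].

Lemma sum_state_weight n a (r : seq (nat * nat)) : 0 < n ->
  uniq r -> all (valid_state n) r -> \sum_(s <- r) state_weight n a s <= S_n n.
Proof.
move=> n_gt0 r_uniq /allP valid_r.
pose h s := (s.1, s.1 + (n %/ s.1 * a + s.1 - s.2) %% s.1).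
rewrite S_nE // -(big_map h xpredT (fun x => quotient_bound x.2 x.1)).
apply: leq_sum_uniq_sub; [|exact: S_index_uniq|].
  rewrite map_inj_in_uniq // => -[t b] [t' b'] /valid_r /and4P /= [t_gt0 _ b_t _].
  move=> /valid_r /and4P /= [_ _ b'_t' _]; rewrite /h /= => -[t_t'].
  subst t' => /addnI.
  move: (n %/ t * a) => c /eqP; rewrite -(eqn_modDr (b + b')).
  have -> : c + t - b + (b + b') = c + t + b' by clear -b_t; lia.
  have -> : c + t - b' + (b + b') = c + t + b by clear -b'_t'; lia.
  by rewrite eqn_modDl !modn_small // => /eqP ->.
move=> y /mapP [[t b] /valid_r /and4P /= [t_gt0 t_n b_t prim] ->].
rewrite /h /= mem_S_index // t_gt0 t_n leq_addr /= mul2n -addnn ltn_add2l ltn_mod t_gt0 /=.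
rewrite /in_J negb_and negbK; have [//|g_neq1 /=] := eqVneq.
apply: contra g_neq1 => g_j.
set g := gcdn t (n %/ t) in g_j *.
have g_t : g %| t by exact: dvdn_gcdl.
have g_al : g %| n %/ t by exact: dvdn_gcdr.
rewrite -dvdn1 -(eqP prim) !dvdn_gcd g_t g_al /= andbT.
set c := n %/ t * a in g_j.
have g_c : g %| c by apply: dvdn_mulr.
have : g %| c + t - b.
  by rewrite (divn_eq (c + t - b) t) dvdn_add ?dvdn_mull // -(dvdn_addr _ g_t).
move=> g_cb; rewrite -(dvdn_addr _ g_cb) subnK ?dvdn_add //.
by apply: leq_trans (ltnW b_t) (leq_addl _ _).
Qed.

(** * Cycles of triangular matrices *)

Lemma iter_cycle_uniq (T : eqType) (f : T -> T) (x : T) (s : seq T) :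
  (forall i, iter i f x \in s) ->
  exists i L, [/\ 0 < L, iter L f (iter i f x) = iter i f x
                & uniq (traject f (iter i f x) L)].
Proof.
move=> in_s; have ex_loop : exists m, looping f x m.
  exists (size s); apply: contraT; rewrite -looping_uniq => u.
  have : size (traject f x (size s).+1) <= size s.
    by apply: uniq_leq_size => // y /trajectP [i _ ->].
  by rewrite size_traject ltnn.
case: (ex_minnP ex_loop) => m loop_m min_m.
have /trajectP [i i_lt i_eq] := loop_m.
exists i, (m - i); rewrite subn_gt0 i_lt -iterD subnK ?(ltnW i_lt) //; split=> //.
have uniq_m : uniq (traject f x m).
  case: (m) min_m {loop_m i_lt i_eq} => [//|m'] min_m; rewrite looping_uniq.
  by apply/negP => /min_m; rewrite ltnn.
suff -> : traject f (iter i f x) (m - i) = drop i (traject f x m) by apply: drop_uniq.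
apply: (@eq_from_nth _ x); first by rewrite size_drop !size_traject.
move=> j; rewrite size_traject => j_lt.
have ij_lt : i + j < m by lia.
rewrite nth_drop nth_traject // (set_nth_default (iter i f x)) ?size_traject //.
by rewrite nth_traject // addnC iterD.
Qed.

Lemma sum_nat_mul_index (G : nat -> nat) L k :
  \sum_(0 <= i < L * k) G i = \sum_(0 <= p < k) \sum_(0 <= j < L) G (j * k + p).
Proof.
rewrite exchange_big_nat /=; elim: L => [|L IHL]; first by rewrite mul0n !big_geq.
rewrite mulSn addnC (big_cat_nat _ (leq_addr k _)) //= IHL big_nat_recr //=; congr addn.
by rewrite -{1}[L * k]add0n big_addn addnC addnK; apply: eq_bigr => p _; rewrite addnC.
Qed.

Local Open Scope R_scope.

Definition eventual_period (y : R) (E : nat) : Prop :=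
  exists l, cq y (l + E) = cq y l.

Definition tail_equiv (y z : R) : Prop := exists k l, cq y k = cq z l.

Lemma tail_match_equiv y z J e : tail_match y z J e -> tail_equiv y z.
Proof. by move=> [k [l [_ eq_kl _]]]; exists k, l. Qed.

Lemma tail_equiv_sym y z : tail_equiv y z -> tail_equiv z y.
Proof. by move=> [k [l eq_kl]]; exists l, k. Qed.

Lemma tail_equiv_trans y z w : tail_equiv y z -> tail_equiv z w -> tail_equiv y w.
Proof.
move=> [k1 [l1 e1]] [k2 [l2 e2]]; exists (k1 + k2)%N, (l2 + l1)%N.
by rewrite !cq_add e1 -e2 -!cq_add addnC.
Qed.

Lemma eventual_period_equiv y z E :
  tail_equiv y z -> eventual_period z E -> eventual_period y E.
Proof.
move=> [k [l e]] [l' e']; exists (k + l')%N.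
by rewrite -addnA !cq_add e -!cq_add addnC cq_add e' -cq_add addnC.
Qed.

Lemma eventual_period_cf y E : (0 < E)%N -> eventual_period y E -> cf_periodic y E.
Proof.
move=> E_gt0 [l e]; split=> //; exists l => i l_i.
by rewrite -(subnKC l_i) addnAC /cf !(cq_add y _ (i - l)) e.
Qed.

Lemma tail_match_self_period y J e : irrational y -> 1 < J -> tail_match y y J e ->
  (0 < e)%Z /\ eventual_period y (Z.to_nat e).
Proof.
move=> irr_y J_gt1 [k [l [e_eq c_eq p_eq]]].
have l_lt_k : (l < k)%N.
  rewrite ltnNge; apply/negP => k_l.
  have : cprod y k <= cprod y l.
    rewrite -(subnKC k_l) cprod_add.
    have := cprod_ge1 (l - k) (irrational_cq (k := k) irr_y).
    by have := cprod_gt0 k irr_y; nra.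
  by rewrite p_eq; have := cprod_gt0 l irr_y; nra.
split; first by lia.
by exists l; rewrite -c_eq; congr cq; lia.
Qed.

Definition state_mobius (n : nat) (s : nat * nat) (x : R) : R :=
  upper_mobius (n %/ s.1) s.2 s.1 x.

Definition good_step (n a : nat) (s s' : nat * nat) : Prop :=
  valid_state n s -> valid_state n s' /\
  forall x, irrational x -> 1 < x ->
    exists2 e, (e <= Z.of_nat (state_weight n a s))%Z
      & tail_match (state_mobius n s (INR a + / x)) (state_mobius n s' x)
          (x * (INR s.1 / INR s'.1)) e.

Lemma exists_good_step n a s : (0 < n)%N -> exists s', good_step n a s s'.
Proof.
move=> n_gt0; have [|/negP nvs] := boolP (valid_state n s); last by exists s => /nvs.
case: s => t b /and4P /= [t_gt0 t_n b_t /eqP prim].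
have al_gt0 : (0 < n %/ t)%N by rewrite divn_gt0 // dvdn_leq.
have [al' [b' [t' [al't' b'_t' prim' m]]]] := upper_mobius_step a al_gt0 b_t prim.
rewrite divnK // in al't'.
have t'_gt0 : (0 < t')%N by apply: leq_ltn_trans b'_t'.
have al'_eq : (n %/ t' = al')%N by rewrite -al't' mulnK.
exists (t', b') => _; split; last by rewrite /state_mobius /= al'_eq; exact: m.
by rewrite /valid_state /= t'_gt0 al'_eq b'_t' prim' eqxx -al't' dvdn_mull.
Qed.

Section Cycle.

Variables (n k : nat) (x : R) (step : nat -> nat * nat -> nat * nat).
Hypotheses (n_gt0 : (0 < n)%N) (k_gt0 : (0 < k)%N).
Hypotheses (irr_x : irrational x) (x_gt1 : 1 < x) (x_per : cq x k = x).
Hypothesis stepP : forall a s, good_step n a s (step a s).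

Let A i := Z.to_nat (cf x i).

Fixpoint run (s : nat * nat) (i : nat) : nat * nat :=
  if i is i'.+1 then step (A i') (run s i') else s.

Let period_map s := run s k.

Lemma cq_pos_decomp i : cq x i = INR (A i) + / cq x i.+1.
Proof.
rewrite /A INR_IZR_INZ Z2Nat.id; first exact: cq_decomp.
have c_gt1 : 1 < cq x i by case: i => [//|i]; exact: cqS_gt1.
have [_ hf] := floorZ_bounds (cq x i).
by have : (0 < cf x i + 1)%Z by [apply: lt_IZR; rewrite plus_IZR /cf; lra]; lia.
Qed.

Lemma run_valid s i : valid_state n s -> valid_state n (run s i).
Proof. by move=> vs; elim: i => [//|i IHi] /=; have [] := stepP (A i) IHi. Qed.

Lemma run_match s m : valid_state n s ->
  exists2 e, (e <= Z.of_nat (\sum_(0 <= i < m) state_weight n (A i) (run s i)))%Z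
    & tail_match (state_mobius n s x) (state_mobius n (run s m) (cq x m))
        (cprod x m * (INR s.1 / INR (run s m).1)) e.
Proof.
move=> vs; have pos i : 0 < INR (run s i).1.
  by apply/lt_0_INR/ltP; case/and4P: (run_valid i vs).
elim: m => [|m [e e_le m_e]].
  exists 0%Z; first by rewrite big_geq.
  apply: tail_match_eq (tail_match_refl _) _ _ => //=.
  by field; have /= := pos 0%N; lra.
have [_ /(_ (cq x m.+1) (irrational_cq irr_x) (cqS_gt1 m irr_x))] := stepP (A m) (run_valid m vs).
rewrite -cq_pos_decomp => -[e' e'_le m_e']; exists (e + e')%Z.
  by rewrite big_nat_recr //= Nat2Z.inj_add; lia.
apply: tail_match_eq (tail_match_trans m_e m_e') _ _ => //.
rewrite -[cprod x m.+1]/(cprod x m * cq x m.+1).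
have p0 := pos m; have p1 := pos m.+1.
by rewrite -[run s m.+1]/(step (A m) (run s m)) in p1 *; field; lra.
Qed.

Lemma A_periodic i j : A (j * k + i) = A i.
Proof.
have cq_jk : cq x (j * k) = x by elim: j => [//|j IHj]; rewrite mulSn cq_add x_per.
by rewrite /A -cf_cq cq_jk.
Qed.

Lemma run_periodic s i j : run s (j * k + i) = run (iter j period_map s) i.
Proof.
have shift j' i' : run s (j' * k + i') = run (run s (j' * k)) i'.
  by elim: i' => [|i' IHi']; rewrite ?addn0 // addnS /= IHi' A_periodic.
rewrite shift; congr run; elim: j => [//|j IHj].
by rewrite iterS -IHj mulSn addnC shift.
Qed.

Lemma run_determined s s' p q : (p <= q)%N -> run s p = run s' p -> run s q = run s' q.
Proof.
move=> p_q; rewrite -(subnKC p_q); elim: (q - p)%N => [|d IHd] e.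
  by rewrite addn0.
by rewrite addnS /= IHd.
Qed.

Lemma state_mobius_period s : valid_state n s ->
  exists E, [/\ (0 < E)%N, (E <= S_n n * k)%N & eventual_period (state_mobius n s x) E].
Proof.
move=> vs.
have in_list i : iter i period_map s \in [seq (t, b) | t <- iota 0 n.+1, b <- iota 0 n.+1].
  rewrite -[iter _ _ _]/(run (iter i period_map s) 0) -run_periodic.
  case: (run _ _) (run_valid (i * k + 0) vs) => t b /and4P [_ t_n b_t _].
  have t_le : (t <= n)%N := dvdn_leq n_gt0 t_n; have b_lt : (b < t)%N := b_t.
  by apply: (allpairs_f pair); rewrite mem_iota; lia.
have [i0 [L [L_gt0 cyc uniq_L]]] := iter_cycle_uniq in_list.
set u := iter i0 period_map s in cyc uniq_L.
have u_run : run s (i0 * k) = u by rewrite -(addn0 (i0 * k)%N) run_periodic.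
have vu : valid_state n u by rewrite -u_run; exact: run_valid.
have cq_jk j : cq x (j * k) = x by elim: j => [//|j IHj]; rewrite mulSn cq_add x_per.
have [e0 _ m0] := run_match (i0 * k) vs; rewrite u_run cq_jk in m0.
have [e e_le m] := run_match (L * k) vu.
have u_cyc : run u (L * k) = u by rewrite -(addn0 (L * k)%N) run_periodic.
rewrite u_cyc cq_jk in m.
have u_pos : 0 < INR u.1 by apply/lt_0_INR/ltP; case/and4P: vu.
have irr_u : irrational (state_mobius n u x).
  apply: irrational_hN => //; case/and4P: vu => t_gt0 t_n _ _.
  have al_gt0 : (0 < n %/ u.1)%N by rewrite divn_gt0 // dvdn_leq.
  by nia.
have J_gt1 : 1 < cprod x (L * k) * (INR u.1 / INR u.1).
  rewrite (_ : INR u.1 / INR u.1 = 1) ?Rmult_1_r; last by field; lra.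
  have : (0 < L * k)%N by rewrite muln_gt0 L_gt0.
  case: (L * k)%N => [//|i] _; rewrite -[cprod x i.+1]/(cprod x i * cq x i.+1).
  by have := cprod_ge1 i irr_x; have := cqS_gt1 i irr_x; nra.
have [e_gt0 per] := tail_match_self_period irr_u J_gt1 m.
exists (Z.to_nat e); split; first by lia.
  have : (\sum_(0 <= i < L * k) state_weight n (A i) (run u i) <= S_n n * k)%N; last by lia.
  rewrite sum_nat_mul_index mulnC.
  apply: (@leq_trans (\sum_(0 <= p < k) S_n n)%N); last by rewrite sum_nat_const_nat subn0.
  rewrite [leqLHS]big_nat [leqRHS]big_nat; apply: leq_sum => p /andP [_ p_k].
  rewrite (eq_bigr (fun j => state_weight n (A p) (run u (j * k + p)))); last first.
    by move=> j _; rewrite A_periodic.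
  rewrite -(big_map (fun j => run u (j * k + p)) xpredT (state_weight n (A p))).
  apply: sum_state_weight => //; last by apply/allP => _ /mapP [j _ ->]; exact: run_valid.
  rewrite map_inj_in_uniq ?iota_uniq // => j j'; rewrite !mem_index_iota /= => j_L j'_L.
  rewrite !run_periodic => /(run_determined (ltnW p_k)).
  rewrite -[run (iter j _ _) k]/(iter j.+1 period_map u).
  rewrite -[run (iter j' _ _) k]/(iter j'.+1 period_map u) => e_jj'.
  have back i : iter L.-1 period_map (iter i.+1 period_map u) = iter i period_map u.
    by rewrite -iterD addnS -addSn prednK // addnC iterD cyc.
  have {}e_jj' : iter j period_map u = iter j' period_map u by rewrite -back e_jj' back.
  apply/eqP; rewrite -(nth_uniq u _ _ uniq_L) ?size_traject // !nth_traject //.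
  exact/eqP.
exact: eventual_period_equiv (tail_match_equiv m0) per.
Qed.

End Cycle.

Lemma state_mobius_eventual_period n k x s : (0 < n)%N -> (0 < k)%N ->
  irrational x -> 1 < x -> cq x k = x -> valid_state n s ->
  exists E, [/\ (0 < E)%N, (E <= S_n n * k)%N & eventual_period (state_mobius n s x) E].
Proof.
move=> n_gt0 k_gt0 irr_x x_gt1 x_per vs.
have [step stepP] := functional_choice (fun as_ s' => good_step n as_.1 as_.2 s')
  (fun as_ => exists_good_step as_.1 as_.2 n_gt0).
apply: (state_mobius_period (step := fun a s => step (a, s))) => // a s'.
exact: (stepP (a, s')).
Qed.

(** * Reduction to triangular matrices *)

Definition primitive_matrix (a b c d : Z) : Prop :=
  forall m : Z, (m | a)%Z -> (m | b)%Z -> (m | c)%Z -> (m | d)%Z -> (m | 1)%Z.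

Lemma hN_cq a b c d x l : irrational x -> (a * d - b * c <> 0)%Z ->
  primitive_matrix a b c d ->
  exists a' b' c' d',
  [/\ Z.abs (a' * d' - b' * c') = Z.abs (a * d - b * c), primitive_matrix a' b' c' d'
    & hN a b c d x = hN a' b' c' d' (cq x l)].
Proof.
move=> irr_x det prim; elim: l => [|l [a' [b' [c' [d' [det' prim' eq_h]]]]]].
  by exists a, b, c, d.
move: (cf x l) (cq_decomp l irr_x) => q x_dec; exists (a' * q + b')%Z, a', (c' * q + d')%Z, c'; split.
- by rewrite -det' -Z.abs_opp; congr Z.abs; ring.
- move=> m m1 m2 m3 m4; apply: prim' => //.
    have -> : b' = (a' * q + b' - a' * q)%Z by ring.
    by apply: Z.divide_sub_r => //; apply: Z.divide_mul_l.
  have -> : d' = (c' * q + d' - c' * q)%Z by ring.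
  by apply: Z.divide_sub_r => //; apply: Z.divide_mul_l.
rewrite eq_h x_dec {x_dec}.
have w_gt1 := cqS_gt1 l irr_x; move: (cq x l.+1) w_gt1 (irrational_cq (k := l.+1) irr_x) => w w_gt1 irr_w.
have den : IZR (c' * q + d') * w + IZR c' <> 0.
  by apply: (mobius_den_neq0 (a := (a' * q + b')%Z) (b := a') irr_w); lia.
rewrite /hN; rewrite !(plus_IZR, mult_IZR) in den *.
have w_neq0 : w <> 0 by lra.
have den2 : IZR c' * (IZR q + / w) + IZR d' <> 0.
  move=> h; apply: den.
  transitivity ((IZR c' * (IZR q + / w) + IZR d') * w); first by field.
  by rewrite h; ring.
by field; repeat split => //.
Qed.

Lemma tail_equiv_pos_upper a b d z : irrational z -> (0 < a)%Z -> (0 < d)%Z ->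
  primitive_matrix a b 0 d -> exists al b' t : nat,
  [/\ Z.of_nat (al * t) = (a * d)%Z, (b' < t)%N, gcdn (gcdn al b') t = 1%N
    & tail_equiv (hN a b 0 d z) (upper_mobius al b' t z)].
Proof.
move=> irr_z a_gt0 d_gt0 prim.
exists (Z.to_nat a), (Z.to_nat ((- b) mod d)), (Z.to_nat d).
have b_mod := Z.mod_pos_bound (- b) d d_gt0.
have b_div := Z.div_mod (- b) d.
have aE : Z.of_nat (Z.to_nat a) = a by lia.
have dE : Z.of_nat (Z.to_nat d) = d by lia.
have bE : Z.of_nat (Z.to_nat ((- b) mod d)) = ((- b) mod d)%Z by rewrite Z2Nat.id //; lia.
have b_eq : b = (- ((- b) / d) * d - (- b) mod d)%Z by lia.
split.
- by rewrite Nat2Z.inj_mul aE dE.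
- by apply/ltP/Nat2Z.inj_lt; rewrite bE dE; lia.
- apply/gcdn3_eq1P => m; rewrite aE bE dE => m_a m_b m_d.
  apply: prim => //; last by exists 0%Z.
  rewrite b_eq; apply: Z.divide_sub_r => //; exact: Z.divide_mul_r.
rewrite /upper_mobius aE bE dE.
have d_neq0 : 0 < IZR d by apply: IZR_lt.
have irr_y : irrational (hN a (- ((- b) mod d)) 0 d z) by apply: irrational_hN => //; nia.
have -> : hN a b 0 d z = hN a (- ((- b) mod d)) 0 d z + IZR (- ((- b) / d)).
  rewrite /hN {1}b_eq minus_IZR mult_IZR !opp_IZR; field; lra.
exact: tail_match_equiv (tail_match_addZ _ irr_y).
Qed.

Lemma tail_equiv_upper a b c d z : irrational z -> (a * d - b * c <> 0)%Z ->
  primitive_matrix a b c d -> exists al b' t : nat,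
  [/\ Z.of_nat (al * t) = Z.abs (a * d - b * c), (b' < t)%N, gcdn (gcdn al b') t = 1%N
    & tail_equiv (hN a b c d z) (upper_mobius al b' t z)].
Proof.
move=> irr_z; have [N c_lt] : exists N : nat, (Z.abs c < Z.of_nat N)%Z.
  by exists (Z.abs_nat c).+1; lia.
elim: N a b c d c_lt => [|N IHN] a b c d c_lt det prim; first by lia.
have irr_y := irrational_hN irr_z det.
have [c0|c_neq0] := Z.eq_dec c 0.
  subst c; rewrite Z.mul_0_r Z.sub_0_r in det *.
  wlog d_gt0 : a b d det prim irr_y {c_lt} / (0 < d)%Z => [hwlog|].
    have d_neq0 : d <> 0%Z by move=> d0; apply: det; rewrite d0 Z.mul_0_r.
    have [d_gt0|d_lt0] : (0 < d)%Z \/ (d < 0)%Z by lia.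
      exact: hwlog.
    have -> : hN a b 0 d z = hN (- a) (- b) 0 (- d) z.
      have : IZR d <> 0 by apply: not_0_IZR; lia.
      by rewrite /hN !opp_IZR => ?; field; lra.
    rewrite -(Z.mul_opp_opp a d); apply: hwlog; try by nia.
    - by move=> m /Z.divide_opp_r ma /Z.divide_opp_r mb mc /Z.divide_opp_r md; exact: prim.
    - by apply: irrational_hN => //; nia.
  have a_neq0 : a <> 0%Z by move=> a0; apply: det; rewrite a0.
  have [a_gt0|a_lt0] : (0 < a)%Z \/ (a < 0)%Z by lia.
    have -> : Z.abs (a * d) = (a * d)%Z by nia.
    exact: tail_equiv_pos_upper.
  have na_gt0 : (0 < - a)%Z by lia.
  have prim' : primitive_matrix (- a) (- b) 0 d.
    by move=> m /Z.divide_opp_r ma /Z.divide_opp_r mb mc md; exact: prim.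
  have [al [b' [t [al_t b'_t gcd1 equiv]]]] := tail_equiv_pos_upper irr_z na_gt0 d_gt0 prim'.
  exists al, b', t; split=> //; first by rewrite al_t; nia.
  apply: tail_equiv_trans equiv; apply: tail_equiv_sym.
  have -> : hN (- a) (- b) 0 d z = - hN a b 0 d z.
    have : IZR d <> 0 by apply: not_0_IZR; lia.
    by rewrite /hN !opp_IZR => ?; field; lra.
  by have [e _ m] := tail_match_opp irr_y; exact: tail_match_equiv m.
set q := (a / c)%Z; have a_eq := Z.div_mod a c c_neq0; rewrite -/q in a_eq.
have r_lt : (Z.abs (a mod c) < Z.abs c)%Z by apply: Z.mod_bound_abs.
have det' : (c * (b - q * d) - d * (a mod c) <> 0)%Z by nia.
have prim' : primitive_matrix c d (a mod c) (b - q * d).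
  move=> m mc md mr mb; apply: prim => //.
    by rewrite a_eq; apply: Z.divide_add_r => //; apply: Z.divide_mul_l.
  have -> : b = (b - q * d + q * d)%Z by ring.
  by apply: Z.divide_add_r => //; apply: Z.divide_mul_r.
have r_lt' : (Z.abs (a mod c) < Z.of_nat N)%Z by lia.
have [al [b' [t [al_t b'_t gcd1 equiv]]]] := IHN _ _ _ _ r_lt' det' prim'.
exists al, b', t; split=> //.
  by rewrite al_t -Z.abs_opp; congr Z.abs; rewrite {2}a_eq; ring.
apply: tail_equiv_trans equiv.
have irr_w := irrational_hN irr_z det'.
have [e [_ _ m]] := tail_match_inv q irr_w.
suff -> : hN a b c d z = IZR q + / hN c d (a mod c) (b - q * d) z by exact: tail_match_equiv m.
have den := mobius_den_neq0 irr_z det; have den' := mobius_den_neq0 irr_z det'.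
rewrite /hN {1}a_eq; rewrite !(minus_IZR, plus_IZR, mult_IZR) in den' *.
by field.
Qed.

Lemma period_upper_bound_primitive x a b c d px ph :
  irrational x -> (a * d - b * c <> 0)%Z -> primitive_matrix a b c d ->
  is_per x px -> is_per (hN a b c d x) ph ->
  (ph <= S_n (Z.abs_nat (a * d - b * c)) * px)%N.
Proof.
move=> irr_x det prim [[px_gt0 [l per_l]] _] [_ min_ph].
have [a' [b' [c' [d' [det' prim' eq_h]]]]] := hN_cq l.+1 irr_x det prim.
have irr_z := irrational_cq (k := l.+1) irr_x.
have z_per : cq (cq x l.+1) px = cq x l.+1.
  by rewrite -cq_add; apply: cf_periodic_cq => // i /ltnW /per_l.
have det'_neq0 : (a' * d' - b' * c' <> 0)%Z by lia.
have [al [b'' [t [al_t b''_t gcd1 equiv]]]] := tail_equiv_upper irr_z det'_neq0 prim'.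
set n := Z.abs_nat (a * d - b * c); have n_gt0 : (0 < n)%N by lia.
have n_eq : (al * t)%N = n by rewrite /n; lia.
have t_gt0 : (0 < t)%N by lia.
have al_eq : (n %/ t = al)%N by rewrite -n_eq mulnK.
have valid : valid_state n (t, b'').
  by rewrite /valid_state /= t_gt0 b''_t al_eq gcd1 -n_eq dvdn_mull.
have [E [E_gt0 E_le E_per]] :=
  state_mobius_eventual_period n_gt0 px_gt0 irr_z (cqS_gt1 l irr_x) z_per valid.
rewrite /state_mobius /= al_eq -/(cq _ l.+1) in E_per.
apply: leq_trans E_le; apply: min_ph; apply: eventual_period_cf => //.
by rewrite eq_h; apply: eventual_period_equiv equiv E_per.
Qed.

Lemma period_upper_bound x a b c d px ph :
  irrational x -> (a * d - b * c <> 0)%Z ->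
  is_per x px -> is_per (hN a b c d x) ph ->
  (ph <= S_n (Z.abs_nat (a * d - b * c)) * px)%N.
Proof.
move=> irr_x det per_x per_y.
set g := Z.gcd (Z.gcd a b) (Z.gcd c d).
have [a1 a_eq] : (g | a)%Z by apply: Z.divide_trans (Z.gcd_divide_l _ _) (Z.gcd_divide_l _ _).
have [b1 b_eq] : (g | b)%Z by apply: Z.divide_trans (Z.gcd_divide_l _ _) (Z.gcd_divide_r _ _).
have [c1 c_eq] : (g | c)%Z by apply: Z.divide_trans (Z.gcd_divide_r _ _) (Z.gcd_divide_l _ _).
have [d1 d_eq] : (g | d)%Z by apply: Z.divide_trans (Z.gcd_divide_r _ _) (Z.gcd_divide_r _ _).
have det_eq : (a * d - b * c = (a1 * d1 - b1 * c1) * (g * g))%Z.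
  by rewrite a_eq b_eq c_eq d_eq; ring.
have g_neq0 : g <> 0%Z by move=> g0; apply: det; rewrite det_eq g0; ring.
have det1 : (a1 * d1 - b1 * c1 <> 0)%Z by move=> h; apply: det; rewrite det_eq h.
have prim : primitive_matrix a1 b1 c1 d1.
  move=> m [a2 a1_eq] [b2 b1_eq] [c2 c1_eq] [d2 d1_eq].
  have : (m * g | g)%Z.
    apply: Z.gcd_greatest; apply: Z.gcd_greatest.
    - by exists a2; rewrite a_eq a1_eq; ring.
    - by exists b2; rewrite b_eq b1_eq; ring.
    - by exists c2; rewrite c_eq c1_eq; ring.
    - by exists d2; rewrite d_eq d1_eq; ring.
  by move=> [k k_eq]; exists k; apply: (Z.mul_reg_r _ _ g) => //; lia.
have eq_h : hN a b c d x = hN a1 b1 c1 d1 x.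
  have gR : IZR g <> 0 by apply: not_0_IZR.
  have den := mobius_den_neq0 irr_x det1.
  rewrite /hN a_eq b_eq c_eq d_eq !mult_IZR; field; split=> //.
  by move=> h; apply: den; apply: (Rmult_eq_reg_r (IZR g)) => //; lra.
rewrite eq_h in per_y.
apply: leq_trans (period_upper_bound_primitive irr_x det1 prim per_x per_y) _.
rewrite leq_mul2r; apply/orP; right.
have -> : Z.abs_nat (a * d - b * c) = (Z.abs_nat (a1 * d1 - b1 * c1) * Z.abs_nat g ^ 2)%N.
  by rewrite det_eq !Zabs2Nat.inj_mul -mulnn.
by apply: S_n_leq_mul_sqr; lia.
Qed.

Lemma hN_adjugate a b c d x : irrational x -> (a * d - b * c <> 0)%Z ->
  hN d (- b) (- c) a (hN a b c d x) = x.
Proof.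
move=> irr_x det; have den := mobius_den_neq0 irr_x det.
have den' : IZR (- c) * hN a b c d x + IZR a <> 0.
  apply: (mobius_den_neq0 (a := d) (b := (- b)%Z)); last by lia.
  exact: irrational_hN.
have detR : IZR a * IZR d - IZR b * IZR c <> 0.
  by rewrite -!mult_IZR -minus_IZR; apply: not_0_IZR.
rewrite {1}/hN; rewrite opp_IZR in den' *.
apply: (Rmult_eq_reg_r (- IZR c * hN a b c d x + IZR a)) => //.
rewrite /Rdiv Rmult_assoc Rinv_l // Rmult_1_r opp_IZR /hN.
by field.
Qed.

Local Close Scope R_scope.

Theorem theorem1 (x : R) (a b c d : Z) (px ph : nat) :
  quadratic_irrational x ->
  (a * d - b * c <> 0)%Z ->
  is_per x px ->
  is_per (hN a b c d x) ph ->
  let n := Z.abs_nat (a * d - b * c) in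
  Rle (Rdiv (INR px) (INR (S_n n))) (INR ph) /\
  Rle (INR ph) (Rmult (INR (S_n n)) (INR px)).
Proof.
move=> [irr_x _] det per_x per_y n.
have upper : (ph <= S_n n * px)%N := period_upper_bound irr_x det per_x per_y.
have lower : (px <= S_n n * ph)%N.
  have det' : (d * a - - b * - c <> 0)%Z by lia.
  have -> : n = Z.abs_nat (d * a - - b * - c) by rewrite /n; congr Z.abs_nat; ring.
  apply: (period_upper_bound (irrational_hN irr_x det) det' per_y).
  by rewrite hN_adjugate.
have px_gt0 : (0 < px)%N by case: per_x => [[]].
split; last by rewrite -mult_INR; apply/le_INR/leP.
have S_gt0 : Rlt 0 (INR (S_n n)).
  by apply/lt_0_INR/ltP; case: (S_n n) lower => // ; rewrite mul0n leqNgt px_gt0.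
apply: (Rmult_le_reg_l (INR (S_n n))) => //.
rewrite -mult_INR (_ : Rmult _ _ = INR px); last by field; lra.
exact/le_INR/leP.
Qed.
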